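(* Let $K$ be a field endowed with a rank-one valuation $v$, with valuation domain $V$, and let $E$ be a subset of $V$. If $E$ does not contain any pseudo-divergent sequence or any pseudo-stationary sequence, then the ring $\mathrm{Int}(E,V)$ has the UCS property.
   Context: The valuation $v$ is rank-one: $v(K^* )$ is a nonzero subgroup of $(\mathbb R,+)$, and $v(0)=\infty$. $\mathrm{Int}(E,V)=\{f\in K[X]\mid f(E)\subseteq V\}$. A sequence $\{x_n\}_{n\ge0}$ of elements of $V$ is pseudo-divergent if $v(x_n-x_m)<v(x_m-x_l)$ for all $n>m>l\ge0$. A sequence $\{x_n\}_{n\ge0}$ of pairwise distinct elements of $V$ is pseudo-stationary if $v(x_n-x_m)=v(x_m-x_l)$ for all $n>m>l\ge0$. The content of a matrix with coefficients in a commutative ring $R$ is the ideal of $R$ generated by its coefficients. The content of a finitely generated submodule $N$ of a free $R$-module $M$ of finite rank is the content of the matrix formed by the components of any finite system of generators of $N$ with respect to any basis of $M$; $N$ has unit content if its content is $R$. A ring $R$ has the UCS property (unit content summand property) if, for every $m$, every finitely generated submodule $N$ of $R^m$ with unit content contains a rank-one projective submodule which is a direct summand of $R^m$. *)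

(* Defs.v *)
From HB Require Import structures.
From mathcomp Require Import all_boot all_order all_algebra.
From mathcomp Require Import boolp classical_sets reals constructive_ereal.

Set Implicit Arguments.
Unset Strict Implicit.
Unset Printing Implicit Defensive.

Import Order.TTheory GRing.Theory Num.Theory.

Local Open Scope classical_set_scope.
Local Open Scope ring_scope.

(* Together, [val0], [val_fin] and [valM] say that v restricts to a group
   morphism from K^* to (R, +), and [val_nontrivial] says that its image is not
   zero. *)
Record rank_one_valuation (K : fieldType) (R : realType) := RankOneValuation {
  valuation :> K -> \bar R;
  val0 : valuation 0 = +oo%E;
  val_fin : forall x, x != 0 -> valuation x \is a fin_num;
  valM : forall x y, valuation (x * y) = (valuation x + valuation y)%E;
  valD : forall x y,
    (Order.min (valuation x) (valuation y) <= valuation (x + y)%R)%E;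
  val_nontrivial : exists2 x, x != 0 & valuation x != 0%E }.

Section IntegerValued.
Variables (K : fieldType) (R : realType) (v : rank_one_valuation K R).

Definition valuation_ring : {pred K} := [pred x | (0 <= v x)%E].

Fact valuation_ring_subring_closed : subring_closed valuation_ring.
Proof.
have v1 : v 1 = 0%E.
  have f1 := val_fin v (oner_neq0 K).
  have := valM v 1 1; rewrite mulr1 -(fineK f1) -EFinD => -[].
  by rewrite -[X in X = _]addr0 => /addrI <-.
have vN1 : v (-1) = 0%E.
  have n1 : (-1 : K) != 0 by rewrite oppr_eq0 oner_eq0.
  have f1 := val_fin v n1.
  have := valM v (-1) (-1).
  rewrite mulrNN mulr1 v1 -(fineK f1) -EFinD => -[] /esym/eqP.
  by rewrite -mulr2n mulrn_eq0 /= => /eqP ->.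
have vM x y : x \in valuation_ring -> y \in valuation_ring ->
    x * y \in valuation_ring.
  by rewrite !inE valM => x0 y0; rewrite adde_ge0.
split=> //; first by rewrite inE v1.
move=> x y x0 y0; rewrite inE; apply: le_trans (valD v x (- y)).
rewrite le_min; apply/andP; split; first by rewrite inE in x0.
have : -1 * y \in valuation_ring by apply: vM; rewrite // inE vN1.
by rewrite mulN1r inE.
Qed.
HB.instance Definition _ :=
  GRing.isSubringClosed.Build K valuation_ring valuation_ring_subring_closed.

Variable E : set K.

Definition int_pred : {pred {poly K}} :=
  [pred f | `[< [set f.[x] | x in E] `<=` [set` valuation_ring] >]].

Fact int_pred_subring_closed : subring_closed int_pred.
Proof.
split=> [|f g /asboolP fE /asboolP gE|f g /asboolP fE /asboolP gE];
    apply/asboolP => _ [x Ex <-] /=.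
- by rewrite hornerC rpred1.
- by rewrite hornerD hornerN; apply: rpredB; [apply: fE|apply: gE]; exists x.
- by rewrite hornerM; apply: rpredM; [apply: fE|apply: gE]; exists x.
Qed.
HB.instance Definition _ :=
  GRing.isSubringClosed.Build {poly K} int_pred int_pred_subring_closed.

(* The ring Int(E, V). *)
Record int_ring := IntRing { int_val : {poly K}; _ : int_val \in int_pred }.
HB.instance Definition _ := [isSub for int_val].
HB.instance Definition _ := [Choice of int_ring by <:].
HB.instance Definition _ := [SubChoice_isSubComNzRing of int_ring by <:].

Definition pseudo_divergent (x : nat -> K) :=
  (forall n, x n \in valuation_ring) /\
  forall n m l, (l < m < n)%N -> (v (x n - x m)%R < v (x m - x l)%R)%E.

Definition pseudo_stationary (x : nat -> K) :=
  [/\ forall n, x n \in valuation_ring,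
      injective x &
      forall n m l, (l < m < n)%N -> v (x n - x m) = v (x m - x l)].

End IntegerValued.

Section SubmoduleType.
Variables (R : pzRingType) (M : lmodType R) (N : submodClosed M).

Record submod_of := Submod { submod_val : M; _ : submod_val \in N }.
HB.instance Definition _ := [isSub for submod_val].
HB.instance Definition _ := [Choice of submod_of by <:].
HB.instance Definition _ := [SubChoice_isSubLmodule of submod_of by <:].

Definition direct_summand :=
  exists Q : submodClosed M,
    (forall x : M, exists y z, [/\ y \in N, z \in Q & x = y + z]) /\
    (forall x : M, x \in N -> x \in Q -> x = 0).

End SubmoduleType.

Definition lin_span (R : pzRingType) (M : lmodType R) n (x : 'I_n -> M) : set M :=
  [set \sum_(i < n) c i *: x i | c in [set: 'I_n -> R]].

Definition finitely_generated (R : pzRingType) (M : lmodType R) :=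
  exists n (x : 'I_n -> M), lin_span x = setT.

Definition projective (R : pzRingType) (P : lmodType R) :=
  forall (A B : lmodType R) (g : {linear A -> B}) (f : {linear P -> B}),
    (forall b, exists a, g a = b) ->
    exists h : {linear P -> A}, forall x, g (h x) = f x.

Section RankOne.
Variable R : comNzRingType.

(* The fraction x / s of the localization M_p is represented by the pair (x, s)
   with s outside p, and [loc_eq p] is equality in M_p. *)
Definition loc_frac (p : prime_idealr R) (M : lmodType R) : set (M * R) :=
  [set q | q.2 \notin p].

Definition loc_eq (p : prime_idealr R) (M : lmodType R) (q q' : M * R) :=
  exists2 u, u \notin p & u *: (q'.2 *: q.1 - q.2 *: q'.1) = 0.

Definition loc_scale (M : lmodType R) (a : R^o * R) (q : M * R) : M * R :=
  (a.1 *: q.1, a.2 * q.2).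

(* M_p is a free R_p-module with a basis of one element. *)
Definition locally_free_rank_one (p : prime_idealr R) (M : lmodType R) :=
  exists2 e : M * R, loc_frac p e &
    (forall q, loc_frac p q -> exists2 a, loc_frac p a & loc_eq p q (loc_scale a e)) /\
    (forall a b, loc_frac p a -> loc_frac p b ->
       loc_eq p (loc_scale a e) (loc_scale b e) -> loc_eq p a b).

Definition rank_one_projective (P : lmodType R) :=
  [/\ finitely_generated P, projective P &
      forall p : prime_idealr R, locally_free_rank_one p P].

End RankOne.

Section UnitContent.
Variable R : comNzRingType.

(* Unlike [idealr], this allows the unit ideal. *)
Definition is_ideal (I : set R) :=
  [/\ I 0, forall a b, I a -> I b -> I (a + b) &
      forall a b, I b -> I (a * b)].

Definition mx_content n m (A : 'M[R]_(n, m)) : set R :=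
  smallest is_ideal [set A ij.1 ij.2 | ij in [set: 'I_n * 'I_m]].

(* The content depends neither on the generators nor on the basis of R^m; the
   components are taken in the standard basis. *)
Definition submod_content m (N : submodClosed 'rV[R]_m) : set R :=
  [set a | exists n (x : 'I_n -> 'rV[R]_m),
     lin_span x = [set` N] /\ mx_content (\matrix_i x i) a].

Definition UCS :=
  forall (m : nat) (N : submodClosed 'rV[R]_m),
    finitely_generated (submod_of N) -> submod_content N = setT ->
    exists P : submodClosed 'rV[R]_m,
      [/\ {subset P <= N}, rank_one_projective (submod_of P) &
          direct_summand P].

End UnitContent.

(* Main.v *)
From HB Require Import structures.
Require Import Defs.
From mathcomp Require Import all_boot all_order all_algebra.
From mathcomp Require Import boolp classical_sets reals constructive_ereal.
From mathcomp Require Import filter ring lra.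

(** Write D for the ring Int(E, V), and let B be a matrix over D whose rows
    generate N; unit content says that the entries of B generate D. A rank-one
    projective direct summand of D^m is the row space of a square matrix p over
    D of trace 1 whose 2 x 2 minors vanish, that is, of an idempotent of rank
    one; it lies in N as soon as p = q B for some q ([fixed_rows_rank_one],
    [fixed_rows_summand]). So a matrix q has to be found ([rank_one_matrix]).

    The hypothesis on E enters through ultrafilters. On a free ultrafilter
    containing E, the values v (y - x) and v (z - y) of a generic triple compare
    in one of three ways; equality or decrease would allow the extraction of a
    pseudo-stationary or pseudo-divergent sequence, hence the values increase
    ([ultra_pseudo_convergent]). Along such an ultrafilter a polynomial behaves
    as along a pseudo-convergent sequence (Ostrowski): the value v (f x) is an
    affine function of the value gamma x of generic differences, with slope in
    nat, and v (f y - f x) is one with positive slope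
    ([ultra_affine_values], [ultra_affine_differences]). Two finiteness
    properties follow: the positive values taken by v o f on E are bounded away
    from 0 ([positive_values_bounded_below]), and if f maps E into V, then f(E)
    meets finitely many residue classes ([finite_residues]).

    Because of the second property, the ring D modulo the functions with
    positive values on E consists of functions with finite image in the residue
    field, and every element f has an inverse q there where it does not vanish
    ([residue_inverse]). So there is a row w in N that has an entry of value 0
    at each point of E ([row_combination_with_units]). By the first property,
    such a row is unimodular modulo each nonzero constant d, that is,
    w a = 1 - d z for suitable a and z ([unimodular_modulo_const]).

    Over the principal ideal domain K[X] the module spanned by N contains a
    unimodular row e ([unit_bilinear_value]). Adding to w a constant multiple of e
    with a coefficient of positive value does not change its residues and, for a
    suitable coefficient, makes it unimodular over K[X], unless w is a multiple
    of e ([unimodular_translate], [coprimep_translate]). In both cases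
    w = h w0 with w0 in N and w0 u0 = 1 for some column u0 over K[X]
    ([saturated_row]). If d is a constant such that d u0 has its entries in D,
    then p = a w + z (d u0) w0 has its rows in N, and it factors over K[X] as a
    column times w0:
    p = (h a + z d u0) w0 with w0 (h a + z d u0) = w a + d z = 1. Thus p has
    rank one and trace 1. *)

Set Implicit Arguments.
Unset Strict Implicit.
Unset Printing Implicit Defensive.

Import Order.TTheory GRing.Theory Num.Theory.

Local Open Scope classical_set_scope.
Local Open Scope ring_scope.

(** * Ultrafilters and extraction of sequences *)

Section Ramsey.
Variables (T : choiceType) (x0 : T) (U : set_system T) (P : T -> T -> T -> Prop).
Context {UF : ProperFilter U}.
Hypothesis UP : \forall x \near U, \forall y \near U, \forall z \near U, P x y z.

(** The list l holds the terms chosen so far, the latest first. The conditions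
    on a further term z are those that keep U-many continuations possible. *)
Fixpoint next_choices (l : seq T) : set T :=
  if l is x :: l' then
    [set z | [/\ next_choices l' z, (\forall t \near U, P x z t) &
                 forall y, List.In y l' -> P y x z]]
  else [set z | \forall y \near U, \forall t \near U, P z y t].

Fixpoint chosen n : seq T :=
  if n is n'.+1 then xget x0 (next_choices (chosen n')) :: chosen n' else [::].

Lemma next_choices_near l x : next_choices l x ->
  (\forall y \near U, \forall t \near U, P x y t) /\
  (forall y, List.In y l -> \forall t \near U, P y x t).
Proof.
elim: l => [|a l IH] /= => [//|[/IH[Px Pl] Pax _]].
by split=> // y [<-//|]; apply: Pl.
Qed.

Lemma next_choices_chosen n : U (next_choices (chosen n)).
Proof.
elim: n => [//|n IH] /=.
have /next_choices_near[] : next_choices (chosen n) (xget x0 (next_choices (chosen n))).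
  by apply: xgetPex; apply: filter_ex IH.
move: (xget x0 _) => x; move: (chosen n) IH => l IH Px Pl.
have Pl' : \forall z \near U, forall y, List.In y l -> P y x z.
  elim: l Pl {IH} => [|a l IHl] Pl; first exact: nearW.
  apply: filterS2 (Pl a (or_introl erefl)) (IHl _) => [z ? ? y [<-//|]|y ly]; first by auto.
  by apply: Pl; right.
by apply: filterS3 IH Px Pl' => z.
Qed.

(** Infinite Ramsey theorem in the form in which a filter has already decided
    the colour: terms are chosen one by one, each in the intersection of the
    finitely many U-large sets that the earlier ones impose. *)
Lemma filter_ramsey : exists s : nat -> T,
  forall n m l, (l < m < n)%N -> P (s l) (s m) (s n).
Proof.
pose s n := xget x0 (next_choices (chosen n)).
have sP n : next_choices (chosen n) (s n).
  by apply: xgetPex; apply: filter_ex (next_choices_chosen n).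
have sIn l m : (l < m)%N -> List.In (s l) (chosen m).
  elim: m => // m IH; rewrite ltnS leq_eqVlt => /predU1P[->|/IH]; first by left.
  by right.
have sub m n : (m <= n)%N -> next_choices (chosen n) `<=` next_choices (chosen m).
  move=> /subnK <-; elim: (n - m)%N => // k IH z /= [/IH ? _ _] //.
exists s => n m l /andP[lm mn].
by have /= [_ _ /(_ _ (sIn _ _ lm))] := sub _ _ mn _ (sP n).
Qed.

End Ramsey.

(** Pigeonhole: an ultrafilter that contains a finite union contains one of the
    sets. *)
Lemma ultra_near_exists (T : Type) (U : set_system T) (I : finType)
    (Q : I -> T -> Prop) : UltraFilter U ->
  (\forall x \near U, exists i, Q i x) -> exists i, \forall x \near U, Q i x.
Proof.
move=> UU UQ; apply: contrapT => /forallNP nQ.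
have /(@filter_forall _ _ _ _ _) nU : forall i, \forall x \near U, ~ Q i x.
  by move=> i; have [/nQ|] := in_ultra_setVsetC (Q i) UU.
by have [x [[i Qx] /(_ i)]] := filter_ex (filterI UQ nU).
Qed.

Lemma ultra_near3 (T : Type) (U : set_system T) (Q : T -> T -> T -> Prop) :
    UltraFilter U ->
  (\forall x \near U, \forall y \near U, \forall z \near U, Q x y z) \/
  (\forall x \near U, \forall y \near U, \forall z \near U, ~ Q x y z).
Proof.
move=> UU; set A := [set x | \forall y \near U, \forall z \near U, Q x y z].
have [?|nA] := in_ultra_setVsetC A UU; [by left|right].
apply: filterS nA => x; set B := [set y | \forall z \near U, Q x y z] => nB.
have [//|nB'] := in_ultra_setVsetC B UU.
by apply: filterS nB' => y nC; have [/nC|] := in_ultra_setVsetC (Q x y) UU.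
Qed.

(** * Computing with a valuation *)

Section Valuation.
Variables (K : fieldType) (R : realType) (v : rank_one_valuation K R).
Implicit Types x y z : K.

Lemma v1 : v 1 = 0%E.
Proof.
have f1 := val_fin v (oner_neq0 K).
have := Defs.valM v 1 1; rewrite mulr1 -(fineK f1) -EFinD => -[].
by rewrite -[X in X = _]addr0 => /addrI <-.
Qed.

Lemma vN1 : v (-1) = 0%E.
Proof.
have f1 : v (-1) \is a fin_num by apply: val_fin; rewrite oppr_eq0 oner_eq0.
have := Defs.valM v (-1) (-1).
rewrite mulrNN mulr1 v1 -(fineK f1) -EFinD => -[] /esym/eqP.
by rewrite -mulr2n mulrn_eq0 /= => /eqP ->.
Qed.

Lemma vN x : v (- x) = v x.
Proof. by rewrite -mulN1r Defs.valM vN1 add0e. Qed.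

Lemma vB x y : v (x - y) = v (y - x).
Proof. by rewrite -vN opprB. Qed.

Lemma v_neq0 x (r : R) : v x = r%:E -> x != 0.
Proof. by move=> vx; apply/eqP => x0; rewrite x0 Defs.val0 in vx. Qed.

Lemma v_finE x : x != 0 -> exists r : R, v x = r%:E.
Proof. by move=> /(val_fin v)/fineK <-; exists (fine (v x)). Qed.

Lemma vV x (r : R) : v x = r%:E -> v x^-1 = (- r)%:E.
Proof.
move=> vx; have x0 := v_neq0 vx.
have [s vs] := v_finE (invr_neq0 x0); rewrite vs.
have := Defs.valM v x x^-1; rewrite divff // v1 vx vs -EFinD => -[] h.
by congr _%:E; lra.
Qed.

Lemma vX x (r : R) n : v x = r%:E -> v (x ^+ n) = (n%:R * r)%:E.
Proof.
move=> vx; elim: n => [|n IH]; first by rewrite expr0 v1 mul0r.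
by rewrite exprS Defs.valM IH vx -EFinD -natr1 mulrDl mul1r addrC.
Qed.

Lemma valD_lt x y : (v x < v y)%E -> v (x + y) = v x.
Proof.
move=> xy; apply/eqP; rewrite eq_le; apply/andP; split; last first.
  by have := Defs.valD v x y; rewrite min_l // ltW.
rewrite leNgt; apply/negP => h.
by have := Defs.valD v (x + y) (- y); rewrite addrK vN leNgt lt_min h xy.
Qed.

Lemma positive_valuation : exists t r, 0 < r /\ v t = r%:E.
Proof.
have [t /v_finE[r vt]] := val_nontrivial v; rewrite vt.
have [r0|r0|->] := ltgtP r 0; last by rewrite eqxx.
- by exists t^-1, (- r); rewrite oppr_gt0 (vV vt).
- by exists t, r.
Qed.

Lemma v_gt0M x y : (0 < v x)%E -> (0 <= v y)%E -> (0 < v (x * y)%R)%E.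
Proof. by move=> x0 y0; rewrite Defs.valM; apply: lt_le_trans x0 (leeDl _ y0). Qed.

Lemma v0M x y : v x = 0%E -> v y = 0%E -> v (x * y) = 0%E.
Proof. by move=> vx vy; rewrite Defs.valM vx vy adde0. Qed.

Lemma v0D x y : v x = 0%E -> (0 < v y)%E -> v (x + y) = 0%E.
Proof. by move=> vx vy; rewrite valD_lt vx. Qed.

Lemma v_exp_ge x (e : R) n : (e%:E <= v x)%E -> ((n%:R * e)%:E <= v (x ^+ n)%R)%E.
Proof.
move=> ex; elim: n => [|n IH]; first by rewrite mul0r expr0 v1.
by rewrite exprS Defs.valM -natr1 mulrDl mul1r addrC EFinD leeD.
Qed.

Lemma v_gt0_prod (I : finType) (F : I -> K) i :
  (forall j, (0 <= v (F j))%E) -> (0 < v (F i))%E -> (0 < v (\prod_j F j)%R)%E.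
Proof.
move=> F0 Fi; rewrite (bigD1 i) //= v_gt0M //.
by elim/big_ind: _ => [|x y|j _]; rewrite ?v1 ?Defs.valM //; apply: adde_ge0.
Qed.

Lemma v_sum_gt (I : Type) (s : seq I) (P : pred I) (F : I -> K) (r : R) :
  (forall i, P i -> (r%:E < v (F i))%E) -> (r%:E < v (\sum_(i <- s | P i) F i)%R)%E.
Proof.
move=> H; elim/big_ind: _ => // [|x y rx ry]; first by rewrite Defs.val0 ltry.
by apply: lt_le_trans (Defs.valD v x y); rewrite lt_min rx.
Qed.

(** When the nonzero terms have pairwise distinct values, the least of these is
    the value of the sum. *)
Lemma v_sum_distinct (I : finType) (A : pred I) (F : I -> K) (t : I -> R) i0 :
    A i0 -> (forall i, A i -> v (F i) = (t i)%:E) ->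
    (forall i, ~~ A i -> F i = 0) ->
    (forall i j, A i -> A j -> i != j -> t i != t j) ->
  exists2 i, A i & v (\sum_i F i) = (t i)%:E.
Proof.
move=> Ai0 vF F0 t_inj; case: (@arg_minP _ R I i0 A t Ai0) => i Ai ti; exists i => //.
rewrite (bigD1 i) //= valD_lt vF //; apply: v_sum_gt => j ji.
have [Aj|/F0->] := boolP (A j); last by rewrite Defs.val0 ltry.
by rewrite vF // lte_fin lt_neqAle ti // t_inj // eq_sym.
Qed.

End Valuation.

(** * Polynomials along a pseudo-convergent ultrafilter *)

Section Ostrowski.
Variables (K : fieldType) (R : realType) (v : rank_one_valuation K R).
Variables (U : set_system K) (UU : UltraFilter U) (gamma : K -> R).
Hypothesis gammaP : \forall x \near U, \forall y \near U,
  v (y - x) = (gamma x)%:E /\ gamma x < gamma y.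

Let UF : ProperFilter U := ultra_proper.
Local Existing Instance UF.

(** Here gamma x is the value of y - x for generic y, so that the ultrafilter is
    the analogue of a pseudo-convergent sequence, with gamma its gauge. *)
Definition affine_values (f : {poly K}) := exists (c : R) (N : nat),
  \forall x \near U, v f.[x] = (c + N%:R * gamma x)%:E.

Definition affine_differences (f : {poly K}) := exists (c : R) (k : nat),
  (0 < k)%N /\
  \forall x \near U, \forall y \near U, v (f.[y] - f.[x]) = (c + k%:R * gamma x)%:E.

Lemma gamma_neq (r : R) : \forall x \near U, gamma x != r.
Proof.
have [gr|//] := in_ultra_setVsetC [set x | gamma x = r] UU; last first.
  by move=> nr; apply: filterS nr => x /eqP.
suff : False by [].
near U => x; near U => y.
have [_] : v (y - x) = (gamma x)%:E /\ gamma x < gamma y.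
  by near: y; near: x; exact: gammaP.
have -> : gamma x = r by near: x; exact: gr.
have -> : gamma y = r by near: y; exact: gr.
by rewrite ltxx.
Unshelve. all: by end_near. Qed.

(** Two affine expressions that differ in the slope along x agree for at most one
    gamma y or, when the slopes along y are equal, for at most one gamma x; but
    gamma is constant on no large set. *)
Lemma affine_neq (c c' : R) (N N' k k' : nat) : k != k' ->
  \forall x \near U, \forall y \near U,
    c + N%:R * gamma y + k%:R * gamma x != c' + N'%:R * gamma y + k'%:R * gamma x.
Proof.
move=> kk'; have [<-|NN'] := eqVneq N N'.
  have kk0 : k%:R - k'%:R != 0 :> R by rewrite subr_eq0 eqr_nat.
  have := gamma_neq ((c' - c) / (k%:R - k'%:R)); apply: filterS => x gx.
  apply: nearW => y; apply: contra gx => /eqP h.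
  apply/eqP/(mulIf kk0); rewrite divfK //; lra.
have NN0 : N%:R - N'%:R != 0 :> R by rewrite subr_eq0 eqr_nat.
apply: nearW => x.
have := gamma_neq ((c' - c + (k'%:R - k%:R) * gamma x) / (N%:R - N'%:R)).
apply: filterS => y; apply: contra => /eqP h.
apply/eqP/(mulIf NN0); rewrite divfK //; lra.
Qed.

(** In the Taylor expansion of f x - f y at the later point y, the terms have
    values c_k + N_k gamma y + k gamma x, where the N_k come from polynomials of
    smaller degree. Expanding at y and not at x makes these values generically
    distinct, so one term k dominates. *)
Lemma taylor_differences (f : {poly K}) : (1 < size f)%N ->
  (forall g : {poly K}, g != 0 -> (size g < size f)%N -> affine_values g) ->
  affine_differences f.
Proof.
move=> f1 IH; have fd : size f = (size f).-1.-1.+2 by case: (size f) f1 => [|[]].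
set d := (size f).-1.-1 in fd.
pose A (i : 'I_d.+1) := f^`N(i.+1) != 0.
have /choice[cN cNP] : forall i : 'I_d.+1, exists cN : R * nat, A i ->
    \forall y \near U, v (f^`N(i.+1)).[y] = (cN.1 + cN.2%:R * gamma y)%:E.
  move=> i; have [Ai|_] := boolP (A i); last by exists (0, 0%N).
  have [|c [N H]] := IH _ Ai; last by exists (c, N).
  rewrite fd ltnS; apply/leq_sizeP => j dj; rewrite coef_nderivn nth_default ?mul0rn //.
  by rewrite fd !addSn !ltnS (leq_trans dj) // leq_addl.
pose c i := (cN i).1; pose N i := (cN i).2.
have Amax : A ord_max.
  apply/eqP => /polyP/(_ 0%N)/eqP; rewrite coef_nderivn addn0 binn coef0 /=.
  by rewrite -[d.+1]/(d.+2.-1) -fd -/(lead_coef f) lead_coef_eq0 -size_poly_eq0 fd.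
pose t (i : 'I_d.+1) x y := c i + (N i)%:R * gamma y + i.+1%:R * gamma x.
have t_inj : \forall x \near U, \forall y \near U, forall ij : 'I_d.+1 * 'I_d.+1,
    ij.1 != ij.2 -> t ij.1 x y != t ij.2 x y.
  have H (ij : 'I_d.+1 * 'I_d.+1) : \forall x \near U, \forall y \near U,
      ij.1 != ij.2 -> t ij.1 x y != t ij.2 x y.
    have [_|ne] := eqVneq ij.1 ij.2; first by apply: nearW => x; apply: nearW.
    have := @affine_neq (c ij.1) (c ij.2) (N ij.1) (N ij.2) ij.1.+1 ij.2.+1 ne.
    by apply: filterS => x; apply: filterS.
  by apply: filterS (filter_forall _ H) => x Hx; exact: filter_forall.
have fN : \forall y \near U, forall i, A i ->
    v (f^`N(i.+1)).[y] = (c i + (N i)%:R * gamma y)%:E.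
  apply: filter_forall => i; have [Ai|nA] := boolP (A i); last exact: nearW.
  by apply: filterS (cNP i Ai).
have [i vi] : exists i, \forall x \near U, \forall y \near U,
    v (f.[y] - f.[x]) = (t i x y)%:E.
  apply: ultra_near_exists.
  suff H : \forall x \near U, \forall y \near U, exists i,
      v (f.[y] - f.[x]) = (t i x y)%:E.
    by apply: filterS H => x; exact: ultra_near_exists.
  near=> x; near=> y.
  have Hinj : forall ij : 'I_d.+1 * 'I_d.+1, ij.1 != ij.2 -> t ij.1 x y != t ij.2 x y.
    by near: y; near: x; exact: t_inj.
  have HN : forall i, A i -> v (f^`N(i.+1)).[y] = (c i + (N i)%:R * gamma y)%:E.
    by near: y; exact: fN.
  have [vyx _] : v (y - x) = (gamma x)%:E /\ gamma x < gamma y.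
    by near: y; near: x; exact: gammaP.
  have -> : f.[y] - f.[x] =
      - \sum_(i < d.+1) (f^`N(i.+1)).[y] * (x - y) ^+ i.+1.
    rewrite -{1}[x](subrK y) (addrC (x - y)) nderiv_taylor; last exact: mulrC.
    by rewrite fd big_ord_recl /= nderivn0 expr0 mulr1 opprD addrA subrr add0r.
  rewrite vN vB in vyx *.
  have Fv i : A i -> v ((f^`N(i.+1)).[y] * (x - y) ^+ i.+1) = (t i x y)%:E.
    by move=> Ai; rewrite Defs.valM HN // (vX _ vyx) -EFinD.
  have F0 (i : 'I_d.+1) : ~~ A i -> (f^`N(i.+1)).[y] * (x - y) ^+ i.+1 = 0.
    by move=> /negPn/eqP->; rewrite horner0 mul0r.
  have [|i _ ->] := v_sum_distinct Amax Fv F0; last by exists i.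
  by move=> i j _ _ ij; exact: (Hinj (i, j)).
(* A positive slope N i contradicts the ultrametric inequality on a generic
   triple: v (f z - f y) would be both t i x y and the larger t i y z. *)
suff N0 : N i = 0%N.
  exists (c i), i.+1; split=> //; apply: filterS vi => x; apply: filterS => y ->.
  by rewrite /t N0 mul0r addr0.
apply/eqP; rewrite -leqn0 leqNgt; apply/negP => Ni.
near U => x; near U => y; near U => z.
have h1 : v (f.[y] - f.[x]) = (t i x y)%:E by near: y; near: x; exact: vi.
have h2 : v (f.[z] - f.[x]) = (t i x z)%:E by near: z; near: x; exact: vi.
have h3 : v (f.[z] - f.[y]) = (t i y z)%:E by near: z; near: y; exact: vi.
have [_ xy] : v (y - x) = (gamma x)%:E /\ gamma x < gamma y.
  by near: y; near: x; exact: gammaP.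
have [_ yz] : v (z - y) = (gamma y)%:E /\ gamma y < gamma z.
  by near: z; near: y; exact: gammaP.
have Nyz : (N i)%:R * gamma y < (N i)%:R * gamma z by rewrite ltr_pM2l ?ltr0n.
have kxy : i.+1%:R * gamma x < i.+1%:R * gamma y by rewrite ltr_pM2l ?ltr0n.
have : v (f.[z] - f.[y]) = (t i x y)%:E.
  have -> : f.[z] - f.[y] = (f.[x] - f.[y]) + (f.[z] - f.[x]) by ring.
  by rewrite valD_lt vB h1 // h2 lte_fin /t; lra.
by rewrite h3 /t => -[]; move: Nyz kxy; clear=> *; lra.
Unshelve. all: by end_near. Qed.

(** Let r x = c + k gamma x be the generic value of f y - f x. If v (f x) < r x
    at some generic x, then v (f y) = v (f x) for generic y; otherwise
    v (f y) >= r y > r x for generic y, so that v (f x) = r x. *)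
Lemma values_of_differences (f : {poly K}) :
  affine_differences f -> affine_values f.
Proof.
move=> [c [k [k0 fP]]].
have [lo|hi] := in_ultra_setVsetC [set x | (v f.[x]%R < (c + k%:R * gamma x)%:E)%E] UU.
  near U => x.
  have lx : (v f.[x]%R < (c + k%:R * gamma x)%:E)%E by near: x; exact: lo.
  have vx : \forall y \near U, v f.[y] = v f.[x].
    have H : \forall y \near U, v (f.[y] - f.[x]) = (c + k%:R * gamma x)%:E.
      by near: x; exact: fP.
    by apply: filterS H => y vyx; rewrite -[f.[y]](subrK f.[x]) addrC valD_lt ?vyx.
  have [r vr] : exists r : R, v f.[x] = r%:E.
    by apply: v_finE; apply/eqP => f0; rewrite f0 Defs.val0 ltNge leey in lx.
  by exists r, 0%N; apply: filterS vx => y ->; rewrite vr mul0r addr0.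
exists c, k; near=> x; near U => y.
have vyx : v (f.[y] - f.[x]) = (c + k%:R * gamma x)%:E by near: y; near: x; exact: fP.
have [_ xy] : v (y - x) = (gamma x)%:E /\ gamma x < gamma y.
  by near: y; near: x; exact: gammaP.
have /negP : ~ (v f.[y]%R < (c + k%:R * gamma y)%:E)%E by near: y; exact: hi.
rewrite -leNgt => hy.
have kxy : k%:R * gamma x < k%:R * gamma y by rewrite ltr_pM2l ?ltr0n.
have -> : f.[x] = - ((f.[y] - f.[x]) + - f.[y]) by ring.
rewrite vN valD_lt vyx // vN; apply: lt_le_trans hy; rewrite lte_fin; lra.
Unshelve. all: by end_near. Qed.

Lemma ultra_affine_values (f : {poly K}) : f != 0 -> affine_values f.
Proof.
have [n] := ubnP (size f); elim: n f => // n IH f; rewrite ltnS => fn f0.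
have [f1|f1] := leqP (size f) 1; last first.
  apply/values_of_differences/taylor_differences => // g g0 gf.
  by apply: IH => //; apply: leq_trans fn.
have [c fc] : exists c, f = c%:P by exists f`_0; exact: size1_polyC.
have [r vr] : exists r : R, v c = r%:E by apply: v_finE; rewrite fc polyC_eq0 in f0.
by exists r, 0%N; apply: nearW => x; rewrite fc hornerC vr mul0r addr0.
Qed.

Lemma ultra_affine_differences (f : {poly K}) :
  (1 < size f)%N -> affine_differences f.
Proof. by move=> f1; apply: taylor_differences => // g g0 _; exact: ultra_affine_values. Qed.

End Ostrowski.

(** * Matrices of polynomials over a field *)

Section PolyMatrix.
Variable F : fieldType.

Section Values.
Variables (n m : nat) (B : 'M[{poly F}]_(n, m)).
Let form (c : 'rV_n) (u : 'cV_m) : {poly F} := (c *m B *m u) 0 0.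

Let formDl c c' u : form (c + c') u = form c u + form c' u.
Proof. by rewrite /form !mulmxDl mxE. Qed.
Let formDr c u u' : form c (u + u') = form c u + form c u'.
Proof. by rewrite /form mulmxDr mxE. Qed.
Let formZl a c u : form (a *: c) u = a * form c u.
Proof. by rewrite /form -!scalemxAl mxE. Qed.
Let formZr a c u : form c (a *: u) = a * form c u.
Proof. by rewrite /form -scalemxAr mxE. Qed.

(** Replaces the Smith normal form: a nonzero value h = c B u of least degree
    divides all values c' B u', hence all entries of B. For values c' B u and
    c B u' this is Euclidean division; in general, subtract multiples of c and u
    so that c' B u = c B u' = 0, and observe that c + c' again gives h with u
    and c' B u' with u'. *)
Lemma unit_bilinear_value (G : 'I_n -> 'I_m -> {poly F}) :
  \sum_i \sum_j G i j * B i j = 1 -> exists (c : 'rV_n) (u : 'cV_m), c *m B *m u = 1%:M.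
Proof.
move=> GB.
have formB i j : form (delta_mx 0 i) (delta_mx j 0) = B i j.
  by rewrite /form -rowE -colE !mxE.
pose sizes k := `[< exists c u, form c u != 0 /\ size (form c u) = k >].
have sizes_ex : exists k, sizes k.
  apply: contrapT => /forallNP none; have /eqP := oner_neq0 {poly F}; apply.
  rewrite -GB big1 // => i _; rewrite big1 // => j _.
  have [->|B0] := eqVneq (B i j) 0; first by rewrite mulr0.
  case: (none (size (B i j))); apply/asboolP.
  by exists (delta_mx 0 i), (delta_mx j 0); rewrite formB.
case: (ex_minnP sizes_ex) => s /asboolP[c [u [h0 hs]]] s_min.
have min c' u' : (size (form c' u') < s)%N -> form c' u' = 0.
  move=> lt; apply/eqP; apply: contraTT lt => v0; rewrite -leqNgt s_min //.
  by apply/asboolP; exists c', u'.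
have dvdr c1 u' : form c1 u = form c u -> form c u %| form c1 u'.
  move=> c1E; rewrite /dvdp.
  have <- : form c1 (u' - (form c1 u' %/ form c u) *: u) = form c1 u' %% form c u.
    rewrite -scaleNr formDr formZr c1E mulNr; apply/eqP.
    by rewrite subr_eq addrC -divp_eq.
  rewrite min // -scaleNr formDr formZr c1E mulNr.
  by rewrite {1}(divp_eq (form c1 u') (form c u)) addrAC subrr add0r -hs ltn_modp.
have dvdl c' : form c u %| form c' u.
  rewrite /dvdp.
  have <- : form (c' - (form c' u %/ form c u) *: c) u = form c' u %% form c u.
    rewrite -scaleNr formDl formZl mulNr; apply/eqP.
    by rewrite subr_eq addrC -divp_eq.
  rewrite min // -scaleNr formDl formZl mulNr.
  by rewrite {1}(divp_eq (form c' u) (form c u)) addrAC subrr add0r -hs ltn_modp.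
have dvd c' u' : form c u %| form c' u'.
  have [q1 c'E] := dvdpP _ _ (dvdl c').
  (* Here c2 B u = 0, and the row c + c2 attains the least value h with u. *)
  pose c2 := c' - q1 *: c.
  have c20 : form c2 u = 0 by rewrite /c2 -scaleNr formDl formZl mulNr c'E subrr.
  have h1 : form c u %| form c2 u'.
    have -> : form c2 u' = form (c + c2) u' - form c u' by rewrite formDl addrC addKr.
    by rewrite dvdp_add ?dvdpNr ?dvdr // formDl c20 addr0.
  have -> : form c' u' = form c2 u' + q1 * form c u'.
    by rewrite /c2 -scaleNr formDl formZl mulNr subrK.
  by rewrite dvdp_add // dvdp_mull // dvdr.
have : form c u %| 1.
  rewrite -GB; elim/big_ind: _ => [|x y|i _]; rewrite ?dvdp0 //; first exact: dvdp_add.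
  elim/big_ind: _ => [|x y|j _]; rewrite ?dvdp0 //; first exact: dvdp_add.
  by rewrite -formB dvdp_mull.
rewrite dvdp1 => /size_poly1P[a a0 ha].
exists (a^-1%:P *: c), u; apply/matrixP => i j; rewrite !ord1 -/(form _ _) formZl ha.
by rewrite -polyCM mulVf // mxE.
Qed.
End Values.

(** The translates of b by distinct constants are pairwise coprime, so each
    translate that is not coprime to p uses up a factor of p of its own. *)
Lemma coprimep_translate (b p : {poly F}) (s : seq F) :
    p != 0 -> uniq s -> (size p <= size s)%N ->
  exists2 l, l \in s & coprimep (b + l%:P) p.
Proof.
elim: s p => [|l s IH] p p0 /=; first by rewrite leqn0 size_poly_eq0 (negPf p0).
move=> /andP[ls us] ps.
have [cop|] := boolP (coprimep (b + l%:P) p); first by exists l; rewrite ?mem_head.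
rewrite {1}/coprimep; set g := gcdp _ _ => g1.
have gp : g %| p := dvdp_gcdr _ _.
have g0 : g != 0 by rewrite gcdp_eq0 (negPf p0) andbF.
have pE := divpK gp; set p1 := p %/ g in pE.
have p10 : p1 != 0 by apply: contraNneq p0 => p10; rewrite -pE p10 mul0r.
have sg : (1 < size g)%N by rewrite ltn_neqAle eq_sym g1 size_poly_gt0.
have [|l' sl' cop] := IH p1 p10 us.
  rewrite -ltnS; apply: leq_trans ps; rewrite -pE size_mul //.
  by case: (size g) sg => [|[|k]] // _; rewrite !addnS /= ltnS leq_addr.
exists l'; first by rewrite inE sl' orbT.
rewrite -pE coprimepMr cop; apply: coprimep_dvdl (dvdp_gcdl _ _) _.
apply/Bezout_eq1_coprimepP; exists ((l' - l)^-1%:P, - (l' - l)^-1%:P) => /=.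
have ll : l' - l != 0 by rewrite subr_eq0; apply: contraNneq ls => <-.
have -> : (l' - l)^-1%:P * (b + l'%:P) + - (l' - l)^-1%:P * (b + l%:P) =
  (l' - l)^-1%:P * (l'%:P - l%:P) by ring.
by rewrite -polyCB -polyCM mulVf.
Qed.

(** If w is not the multiple b e of e, with b = w u, take for p a nonzero entry
    of w - b e. A common factor of the entries of w + l e divides
    (w + l e) u = b + l, hence also w - b e, hence p. *)
Lemma unimodular_translate m (w e : 'rV[{poly F}]_m) (u : 'cV[{poly F}]_m) :
    e *m u = 1%:M ->
  w = ((w *m u) 0 0) *: e \/
  exists2 p : {poly F}, p != 0 & forall l : F,
    coprimep ((w *m u) 0 0 + l%:P) p ->
    exists u0, (w + l%:P *: e) *m u0 = 1%:M.
Proof.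
move=> eu; set b := (w *m u) 0 0.
have [?|wb] := eqVneq w (b *: e); [by left|right].
have [j wj] : exists j, w 0 j - b * e 0 j != 0.
  apply: contrapT => /forallNP wj; move/eqP: wb; apply; apply/rowP => j.
  by apply/eqP; rewrite -subr_eq0 mxE; exact/negPn/negP/wj.
exists (w 0 j - b * e 0 j) => // l /Bezout_eq1_coprimepP[[al be] /= h].
(* With w' = w + l e, this column makes explicit that b + l = w' u and
   p = w' j - (w' u) e j are linear combinations of the entries of w'. *)
exists (al *: u + be *: (delta_mx j 0 - e 0 j *: u)).
apply/matrixP => i k; rewrite !ord1 {i k} mulmxDr -!scalemxAr mulmxBr -scalemxAr -colE.
have : ((w + l%:P *: e) *m u) 0 0 = b + l%:P.
  by rewrite mulmxDl mxE -scalemxAl eu; congr (_ + _); rewrite !mxE mulr1.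
move: ((w + l%:P *: e) *m u) => x xE; rewrite !mxE xE /= -h; ring.
Qed.

End PolyMatrix.

(** * Rank-one idempotent matrices *)

Section RankOneMatrix.
Variables (R : comNzRingType) (m : nat) (p : 'M[R]_m).

(** For an idempotent p these are the image and the kernel of the projection
    that p defines on row vectors. *)
Definition fixed_rows : {pred 'rV[R]_m} := [pred y | y *m p == y].
Definition killed_rows : {pred 'rV[R]_m} := [pred y | y *m p == 0].

Fact fixed_rows_submod_closed : submod_closed fixed_rows.
Proof.
split=> [|a y z]; rewrite !inE ?mul0mx // => /eqP yp /eqP zp.
by rewrite mulmxDl -scalemxAl yp zp.
Qed.
HB.instance Definition _ :=
  GRing.isSubmodClosed.Build R 'rV[R]_m fixed_rows fixed_rows_submod_closed.

Fact killed_rows_submod_closed : submod_closed killed_rows.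
Proof.
split=> [|a y z]; rewrite !inE ?mul0mx // => /eqP yp /eqP zp.
by rewrite mulmxDl -scalemxAl yp zp scaler0 addr0.
Qed.
HB.instance Definition _ :=
  GRing.isSubmodClosed.Build R 'rV[R]_m killed_rows killed_rows_submod_closed.

Hypotheses (p_tr : \tr p = 1)
  (p_minor : forall i j k l, p i j * p k l = p i l * p k j).

(** The vanishing of the 2 x 2 minors gives p^2 = (tr p) p. *)
Lemma rank_one_idempotent : p *m p = p.
Proof.
apply/matrixP => i j; rewrite mxE.
under eq_bigr => k _ do rewrite p_minor.
by rewrite -mulr_sumr -[X in _ * X]/(\tr p) p_tr mulr1.
Qed.

Lemma row_fixed i : row i p \in fixed_rows.
Proof. by rewrite inE -row_mul rank_one_idempotent. Qed.

Local Notation P := (submod_of fixed_rows).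
Local Notation gen i := (Submod (row_fixed i) : P).

Lemma fixed_rowsE (y : P) : y = \sum_i val y 0 i *: gen i.
Proof.
apply/val_inj; rewrite raddf_sum -[LHS](eqP (valP y)) mulmx_sum_row.
by apply: eq_bigr.
Qed.

Lemma fixed_row_proportional (y : P) i : p i i *: val y = val y 0 i *: row i p.
Proof.
have /eqP yp := valP y; apply/rowP => j; rewrite !mxE.
rewrite -{1}yp -[in RHS]yp !mxE mulr_sumr mulr_suml; apply: eq_bigr => k _.
by rewrite mulrCA -mulrA; congr (_ * _); rewrite p_minor mulrC.
Qed.

(** The rows of p are lifted arbitrarily, and the lift is extended linearly by
    means of the coordinates of y in R^m, which express y through the rows of p
    by [fixed_rowsE]. *)
Lemma fixed_rows_projective : projective P.
Proof.
move=> A B g f g_surj.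
have /choice[a aP] := fun i => g_surj (f (gen i)).
pose h (y : P) : A := \sum_i val y 0 i *: a i.
have h_lin : linear h.
  move=> c y z; rewrite /h scaler_sumr -big_split; apply: eq_bigr => i _ /=.
  by rewrite !mxE scalerDl scalerA.
pose hL : {linear P -> A} := HB.pack h (GRing.isLinear.Build R P A _ h h_lin).
exists hL => y; rewrite [in RHS](fixed_rowsE y) /= /h !linear_sum.
by apply: eq_bigr => i _; rewrite !linearZ_LR aP.
Qed.

(** Since the diagonal entries of p add up to 1, one of them, p i i, is outside
    the given prime ideal; then row i of p is a basis of the localization,
    by [fixed_row_proportional]. *)
Lemma fixed_rows_rank_one : rank_one_projective P.
Proof.
split; last 1 first.
- move=> q.
  have [i pi] : exists i, p i i \notin q.
    apply: contrapT => /forallNP all_in.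
    have := idealr1 q; rewrite -p_tr rpred_sum // => i _.
    exact/negPn/negP/all_in.
  exists (gen i, 1); first by rewrite /loc_frac /= idealr1.
  split=> [[y s] ys|[a1 a2] [b1 b2] a2q b2q].
    exists (val y 0 i, s * p i i).
      by rewrite /loc_frac /= prime_idealrM negb_or pi andbT.
    exists 1; first by rewrite idealr1.
    apply/val_inj; rewrite scale1r /= mulr1 -scalerA fixed_row_proportional.
    by rewrite subrr.
  case=> u uq /(congr1 val)/(congr1 (fun r : 'rV_m => r 0 i)) /=.
  rewrite !mulr1 !mxE => e.
  exists (u * p i i); first by rewrite prime_idealrM negb_or uq.
  by rewrite /GRing.scale /=; rewrite -e; ring.
- exists m, (fun i => gen i); apply/seteqP; split=> // y _.
  by exists (fun i => val y 0 i) => //; rewrite -fixed_rowsE.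
- exact: fixed_rows_projective.
Qed.

Lemma fixed_rows_summand : direct_summand fixed_rows.
Proof.
exists (killed_rows : submodClosed _); split=> [x|x]; last by rewrite !inE => /eqP -> /eqP.
exists (x *m p), (x - x *m p); rewrite !inE -mulmxA rank_one_idempotent eqxx.
by rewrite mulmxBl -mulmxA rank_one_idempotent subrr addrC subrK.
Qed.

End RankOneMatrix.

(** The combinations of the entries form an ideal, so that membership of 1 in
    the content provides explicit coefficients. *)
Lemma mx_content_unit (R : comNzRingType) n m (A : 'M[R]_(n, m)) :
  mx_content A 1 -> exists G : 'I_n -> 'I_m -> R, \sum_i \sum_j G i j * A i j = 1.
Proof.
pose I := [set a | exists G : 'I_n -> 'I_m -> R, \sum_i \sum_j G i j * A i j = a].
move=> /(_ I); apply; split.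
  split=> [|_ _ [G <-] [H <-]|a _ [G <-]].
  - by exists (fun _ _ => 0); rewrite big1 // => i _; rewrite big1 // => j _; rewrite mul0r.
  - exists (fun i j => G i j + H i j); rewrite -big_split; apply: eq_bigr => i _ /=.
    by rewrite -big_split; apply: eq_bigr => j _; rewrite mulrDl.
  - exists (fun i j => a * G i j); rewrite mulr_sumr; apply: eq_bigr => i _.
    by rewrite mulr_sumr; apply: eq_bigr => j _; rewrite mulrA.
move=> _ [[i j] _ <-] /=; exists (fun i' j' => (i' == i)%:R * (j' == j)%:R).
rewrite (bigD1 i) //= (bigD1 j) //= !eqxx !mul1r !big1 ?addr0 // => k /negPf ki.
  by rewrite big1 // => l _; rewrite ki !mul0r.
by rewrite ki mulr0 mul0r.
Qed.

Section IntegerValued.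
Variables (K : fieldType) (R : realType) (v : rank_one_valuation K R) (E : set K).
Hypotheses (E_sub_V : E `<=` [set` valuation_ring v])
    (no_pseudo_div : ~ exists x : nat -> K,
       (forall n, E (x n)) /\ pseudo_divergent v x)
    (no_pseudo_stat : ~ exists x : nat -> K,
       (forall n, E (x n)) /\ pseudo_stationary v x).

(** * Values of a polynomial on E *)

Section FreeUltrafilter.
Variables (U : set_system K) (UU : UltraFilter U).
Hypotheses (UE : U E) (U_free : forall x, \forall y \near U, y != x).

(** The ultrafilter decides how v (y - x) and v (z - y) compare on generic
    triples; two of the three answers are excluded by [filter_ramsey], which
    would produce one of the forbidden sequences in E. *)
Lemma ultra_pseudo_convergent :
  \forall x \near U, \forall y \near U, \forall z \near U,
    (v (y - x)%R < v (z - y)%R)%E.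
Proof.
have extract (Q : K -> K -> K -> Prop) :
    (\forall x \near U, \forall y \near U, \forall z \near U, Q x y z) ->
    exists s : nat -> K, [/\ forall n, E (s n), forall n, s n \in valuation_ring v,
      injective s & forall n m l, (l < m < n)%N -> Q (s l) (s m) (s n)].
  move=> UQ; have [|s sP] := @filter_ramsey _ 0 U
      (fun x y z => [/\ E x, y != x & Q x y z]).
    apply: filterS2 UE UQ => x Ex; apply: filterS2 (U_free x) => y ?.
    by apply: filterS => z.
  have sE n : E (s n) by have [] := sP n.+2 n.+1 n; rewrite ?leqnn.
  exists s; split=> // [n|l m slm|n m l /sP[]//]; first exact: E_sub_V.
  have inj (i j : nat) : (i < j)%N -> s j != s i.
    by move=> ij; have [] := sP j.+1 j i; rewrite ?ij ?leqnn.
  by case: (ltngtP l m) => // /inj; rewrite slm eqxx.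
have [//|H1] := ultra_near3 (fun x y z => v (y - x)%R < v (z - y)%R)%E UU.
have [H2|H2] := ultra_near3 (fun x y z => v (z - y)%R = v (y - x)%R) UU.
  have [s [sE sV s_inj sQ]] := extract _ H2.
  by exfalso; apply: no_pseudo_stat; exists s; split.
have [|s [sE sV s_inj sQ]] := extract (fun x y z => v (z - y)%R < v (y - x)%R)%E.
  apply: filterS2 H1 H2 => x; apply: filterS2 => y; apply: filterS2 => z.
  by move=> /negP; rewrite -leNgt le_eqVlt => /orP[/eqP|].
by exfalso; apply: no_pseudo_div; exists s; split.
Qed.

(** For generic x, y and z the difference z - y is smaller than y - x, so that
    v (z - x) = v (y - x) does not depend on the generic point. *)
Lemma ultra_gauge : exists gamma : K -> R,
  \forall x \near U, \forall y \near U, v (y - x) = (gamma x)%:E /\ gamma x < gamma y.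
Proof.
have pc := ultra_pseudo_convergent.
pose gamma x := xget 0 [set r : R | \forall y \near U, v (y - x) = r%:E].
have gammaP : \forall x \near U, \forall y \near U, v (y - x) = (gamma x)%:E.
  apply: filterS pc => x pcx.
  suff /xgetPex : exists r : R, \forall y \near U, v (y - x) = r%:E by apply.
  have [y [yx pcy]] := filter_ex (filterI (U_free x) pcx).
  have [r vr] : exists r : R, v (y - x) = r%:E by apply: v_finE; rewrite subr_eq0.
  exists r; apply: filterS pcy => z yz.
  have -> : z - x = (y - x) + (z - y) by ring.
  by rewrite valD_lt.
exists gamma; near=> x; near=> y.
have vyx : v (y - x) = (gamma x)%:E by near: y; near: x.
split=> //; near U => z.
have vzy : v (z - y) = (gamma y)%:E by near: z; near: y.
rewrite -lte_fin -vyx -vzy; near: z; near: y; near: x; exact: pc.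
Unshelve. all: by end_near. Qed.

End FreeUltrafilter.

(** Otherwise some ultrafilter on E has v (f y) < v (f x) for generic y, which an
    affine function of gamma with nonnegative slope does not allow. *)
Lemma positive_values_bounded_below (f : {poly K}) : exists2 d : R, 0 < d &
  forall x, E x -> (0 < v f.[x]%R)%E -> (d%:E <= v f.[x]%R)%E.
Proof.
apply: contrapT => nbound.
pose A (d : R) := [set x | E x /\ (0 < v f.[x]%R < d%:E)%E].
have A0 d : 0 < d -> A d !=set0.
  move=> d0; apply: contrapT => /forallNP nA; apply: nbound; exists d => // x Ex fx.
  by rewrite leNgt; apply/negP => xd; apply: (nA x); rewrite /A /= fx.
have AF : Filter (filter_from [set d | 0 < d] A).
  apply: filter_from_filter; first by exists 1; rewrite /= ltr01.
  move=> c d c0 d0; exists (Order.min c d); first by rewrite /= lt_min c0.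
  by move=> x [Ex]; rewrite EFin_min lt_min => /and3P[? ? ?]; split; split=> //; apply/andP.
have [U [UU AU]] := ultraFilterLemma (filter_from_proper AF A0).
have UA d : 0 < d -> U (A d) by move=> d0; apply: AU; exists d.
have U1 := UA 1 ltr01.
have UE : U E by apply: filterS U1 => x [].
(* Points x with v (f x) <= 0 are in no set A d; including them here lets U be
   shown to be free at every x. *)
have below x : \forall y \near U, (v f.[x]%R <= 0)%E \/ (v f.[y]%R < v f.[x]%R)%E.
  have [fx0|fx0] := leP (v f.[x]) 0%E; first by apply: nearW; left.
  have [f0|/(v_finE v)[r vr]] := eqVneq f.[x] 0.
    rewrite f0 Defs.val0; apply: filterS U1 => y [_ /andP[_ h]]; right.
    exact: lt_trans h (ltry _).
  have r0 : 0 < r by rewrite -lte_fin -vr.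
  by apply: filterS (UA r r0) => y [_ /andP[_]]; rewrite vr; right.
have U_free x : \forall y \near U, y != x.
  apply: filterS2 U1 (below x) => y [_ /andP[fy _]] [fx|fyx]; apply/eqP => yx.
    by rewrite yx ltNge fx in fy.
  by rewrite yx ltxx in fyx.
have f0 : f != 0.
  have [x [_ /andP[_ h]]] := filter_ex U1; apply/eqP => f0.
  by rewrite f0 horner0 Defs.val0 ltNge leey in h.
have [gamma gammaP] := ultra_gauge UU UE U_free.
have [c [N cN]] := ultra_affine_values UU gammaP f0.
suff : False by [].
near U => x; near U => y.
have [_ xy] : v (y - x) = (gamma x)%:E /\ gamma x < gamma y.
  by near: y; near: x.
have vx : v f.[x] = (c + N%:R * gamma x)%:E by near: x.
have vy : v f.[y] = (c + N%:R * gamma y)%:E by near: y.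
have [_ /andP[fx0 _]] : A 1 x by near: x.
have [|] : (v f.[x]%R <= 0)%E \/ (v f.[y]%R < v f.[x]%R)%E by near: y.
  by rewrite leNgt fx0.
by rewrite vx vy lte_fin ltrD2l ltNge ler_wpM2l // ?ler0n // ltW.
Unshelve. all: by end_near. Qed.

(** Otherwise some ultrafilter on E avoids every residue class of f, so that
    v (f y - f x) = 0 for generic x and y, whereas this value grows with x. *)
Lemma finite_residues (f : {poly K}) : (forall x, E x -> (0 <= v f.[x]%R)%E) ->
  exists s : seq K, forall x, E x -> exists2 a, a \in s & (0 < v (f.[x] - a)%R)%E.
Proof.
move=> fV; apply: contrapT => /forallNP ninf.
pose A (s : seq K) := [set x | E x /\ forall a, a \in s -> (v (f.[x] - a)%R <= 0)%E].
have A0 s : setT s -> A s !=set0.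
  move=> _; apply: contrapT => /forallNP nA; apply: (ninf s) => x Ex.
  apply: contrapT => /forall2NP na; apply: (nA x); split=> // a sa.
  by rewrite leNgt; apply/negP; case: (na a).
have AF : Filter (filter_from setT A).
  apply: filter_from_filter; first by exists [::].
  move=> s t _ _; exists (s ++ t) => // x [Ex st].
  by split; split=> // a sa; apply: st; rewrite mem_cat sa ?orbT.
have [U [UU AU]] := ultraFilterLemma (filter_from_proper AF A0).
have UA s : U (A s) by apply: AU; exists s.
have UE : U E by apply: filterS (UA [::]) => x [].
have apart x : \forall y \near U, (v (f.[y] - f.[x])%R <= 0)%E.
  by apply: filterS (UA [:: f.[x]]) => y [_]; apply; rewrite inE.
have U_free x : \forall y \near U, y != x.
  apply: filterS (apart x) => y; apply: contraTneq => ->.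
  by rewrite subrr Defs.val0 -ltNge ltry.
have f1 : (1 < size f)%N.
  rewrite ltnNge; apply/negP => /size1_polyC fc.
  have [x hx] := filter_ex (apart 0).
  by rewrite fc !hornerC subrr Defs.val0 leNgt ltry in hx.
have [gamma gammaP] := ultra_gauge UU UE U_free.
have [c [k [k0 ck]]] := ultra_affine_differences UU gammaP f1.
suff : False by [].
have vdiff x y : E x -> E y -> (0 <= v (f.[y] - f.[x])%R)%E.
  move=> /fV fx /fV fy; apply: le_trans (Defs.valD v _ _).
  by rewrite le_min fy vN.
near U => x; near U => y; near U => z.
have Ex : E x by near: x.
have Ey : E y by near: y.
have Ez : E z by near: z.
have [_ xy] : v (y - x) = (gamma x)%:E /\ gamma x < gamma y.
  by near: y; near: x.
have vyx : v (f.[y] - f.[x]) = (c + k%:R * gamma x)%:E by near: y; near: x.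
have vzy : v (f.[z] - f.[y]) = (c + k%:R * gamma y)%:E by near: z; near: y.
have hzy : (v (f.[z] - f.[y])%R <= 0)%E by near: z.
have := vdiff _ _ Ex Ey; rewrite leNgt => /negP; apply.
rewrite vyx; apply: lt_le_trans hzy; rewrite vzy lte_fin ltrD2l ltr_pM2l // ltr0n //.
Unshelve. all: by end_near. Qed.

(** * The ring of integer-valued polynomials *)

Local Notation D := (int_ring v E).
Local Notation mval := (map_mx (val : D -> {poly K})).

(** The composite is given a name of its own to carry a ring morphism structure. *)
Definition eval_at (x : K) : D -> K := horner_eval x \o \val.
HB.instance Definition _ x :=
  GRing.RMorphism.copy (eval_at x) (horner_eval x \o (\val : D -> {poly K})).

Lemma eval_atE x (f : D) : eval_at x f = (\val f).[x].
Proof. by []. Qed.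

Lemma eval_at_ge0 x (f : D) : E x -> (0 <= v (eval_at x f))%E.
Proof. by move=> Ex; have /asboolP := valP f; apply; exists x. Qed.

Lemma int_ring_lift (p : {poly K}) :
  (forall x, E x -> (0 <= v p.[x]%R)%E) -> exists f : D, \val f = p.
Proof.
move=> pV; have pE : p \in int_pred v E by apply/asboolP => _ [x Ex <-]; exact: pV.
by exists (IntRing pE).
Qed.

Lemma int_ring_const (a : K) : (0 <= v a)%E ->
  exists f : D, \val f = a%:P /\ forall x, eval_at x f = a.
Proof.
move=> va; have [x _|f fa] := @int_ring_lift a%:P; first by rewrite hornerC.
by exists f; split=> // x; rewrite eval_atE fa hornerC.
Qed.

(** Let a run over representatives in V of the invertible residue classes met by
    f. The product of the 1 - f / a has the form 1 - f q, and at a point where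
    f has value 0 one of the factors has positive value. *)
Lemma residue_inverse (f : D) : exists q : D, forall x, E x ->
  v (eval_at x f) = 0%E -> (0 < v (1 - eval_at x f * eval_at x q)%R)%E.
Proof.
have [s sP] := finite_residues (fun x Ex => eval_at_ge0 f Ex).
suff [q qP] : exists q : D, forall x, E x -> v (eval_at x f) = 0%E ->
    forall a, a \in s -> (0 < v (eval_at x f - a)%R)%E ->
    (0 < v (1 - eval_at x f * eval_at x q)%R)%E.
  by exists q => x Ex fx; have [a sa xa] := sP x Ex; exact: (qP x Ex fx a).
elim: s {sP} => [|a s [q qP]]; first by exists 0.
have [va|va] := eqVneq (v a) 0%E; last first.
  exists q => x Ex fx b; rewrite inE => /predU1P[->|]; last exact: qP.
  move=> fa; have : v a = 0%E; last by move/eqP: va.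
  have -> : a = eval_at x f - (eval_at x f - a) by ring.
  by rewrite v0D ?vN.
have va' : v a^-1 = 0%E by rewrite (vV va) oppr0.
have [|c [_ cE]] := @int_ring_const a^-1; first by rewrite va'.
exists (q + c - c * f * q) => x Ex fx b sb fb.
rewrite !(rmorphB, rmorphD, rmorphM) /= cE.
set y := eval_at x f in fx fb *; set z := eval_at x q.
have -> : 1 - y * (z + a^-1 - a^-1 * y * z) = (1 - a^-1 * y) * (1 - y * z) by ring.
have z0 : (0 <= v z)%E by exact: eval_at_ge0.
have [bE|bs] := predU1P sb; last first.
  rewrite mulrC; apply: v_gt0M; first exact: qP fb.
  by apply: le_trans (Defs.valD v _ _); rewrite le_min v1 vN (v0M va' fx) lexx.
apply: v_gt0M; last first.
  by apply: le_trans (Defs.valD v _ _); rewrite le_min v1 vN Defs.valM fx add0e z0 lexx.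
have -> : 1 - a^-1 * y = - (a^-1 * (y - b)).
  by rewrite mulrBr bE mulVf ?opprB // (v_neq0 va).
by rewrite vN Defs.valM va' add0e.
Qed.

(** The row w(x) is unimodular over V at each point x of E separately. *)
Definition residually_unimodular m (w : 'rV[D]_m) :=
  forall x, E x -> exists j, v (eval_at x (w 0 j)) = 0%E.

(** Rows are added one at a time. The next row is multiplied by chi, which is
    invertible modulo the maximal ideal at the points where the current
    combination w has no invertible entry, and 0 modulo it at the others; there
    the residues of w are kept. *)
Lemma row_combination_with_units n m (B : 'M[D]_(n, m)) :
    (forall x, E x -> exists i j, v (eval_at x (B i j)) = 0%E) ->
  exists c : 'rV[D]_n, residually_unimodular (c *m B).
Proof.
move=> Bunit.
suff H k : (k <= n)%N -> exists c : 'rV[D]_n, forall x, E x -> forall (i : 'I_n) j,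
    (i < k)%N -> v (eval_at x (B i j)) = 0%E ->
    exists j, v (eval_at x ((c *m B) 0 j)) = 0%E.
  have [c cP] := H n (leqnn n); exists c => x Ex.
  by have [i [j ij]] := Bunit x Ex; apply: cP ij.
elim: k => [_|k IH kn]; first by exists 0 => x _ i j; rewrite ltn0.
have [c cP] := IH (ltnW kn); set w := c *m B in cP.
have /choice[q qP] := fun j => residue_inverse (w 0 j).
pose chi : D := \prod_j (1 - w 0 j * q j).
have chiE x : eval_at x chi = \prod_j (1 - eval_at x (w 0 j) * eval_at x (q j)).
  by rewrite rmorph_prod; apply: eq_bigr => j _; rewrite rmorphB rmorph1 rmorphM.
pose k' := Ordinal kn.
exists (c + chi *: delta_mx 0 k') => x Ex i j ik Bij.
have wE j' : eval_at x (((c + chi *: delta_mx 0 k') *m B) 0 j') =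
    eval_at x (w 0 j') + eval_at x chi * eval_at x (B k' j').
  by rewrite mulmxDl -scalemxAl -rowE !mxE rmorphD rmorphM.
have [[j' wj']|nw] := pselect (exists j', v (eval_at x (w 0 j')) = 0%E).
  exists j'; rewrite wE v0D // v_gt0M ?eval_at_ge0 // chiE.
  apply: (v_gt0_prod (i := j')); last exact: qP.
  by move=> j''; rewrite -rmorphM -(rmorph1 (eval_at x)) -rmorphB eval_at_ge0.
have w0 j' : (0 < v (eval_at x (w 0 j'))%R)%E.
  by rewrite lt_neqAle eval_at_ge0 // andbT eq_sym; apply/eqP => h; apply: nw; exists j'.
have chi0 : v (eval_at x chi) = 0%E.
  rewrite chiE; elim/big_ind: _ => [|y z|j' _]; [exact: v1|exact: v0M|].
  by rewrite v0D ?v1 // vN v_gt0M ?eval_at_ge0.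
exists j; rewrite wE addrC v0D // v0M //.
have [ik'|ik'] := ltnP i k; first by case: nw; exact: cP ik' Bij.
suff -> : k' = i by [].
by apply/val_inj/eqP; rewrite eqn_leq ik' -ltnS ik.
Qed.

(** A combination g of the entries of w has value 0 on all of E, so t = 1 - g q
    has positive values there for some q. These are bounded away from 0, hence
    a power of t is divisible by d, and 1 - t^k is a multiple of g. *)
Lemma unimodular_modulo_const m (w : 'rV[D]_m) (d : K) : d != 0 ->
    residually_unimodular w ->
  exists (a : 'cV[D]_m) (z : D), \val ((w *m a) 0 0) = 1 - d%:P * \val z.
Proof.
move=> d0 wunit.
have [x Ex|c cP] := @row_combination_with_units _ _ w^T.
  by have [j wj] := wunit x Ex; exists j, 0; rewrite mxE.
set g := (c *m w^T) 0 0.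
have gunit x : E x -> v (eval_at x g) = 0%E.
  by move=> /cP[j]; rewrite ord1.
have [q qP] := residue_inverse g.
pose t := 1 - g * q.
have t_gt0 x : E x -> (0 < v (eval_at x t))%E.
  by move=> Ex; rewrite rmorphB rmorph1 rmorphM; apply: qP; rewrite ?gunit.
have [e e0 te] := positive_values_bounded_below (\val t).
have [r vd] := v_finE v d0.
have [k rk] : exists k : nat, r <= k%:R * e.
  exists (Num.truncn (r / e)).+1; rewrite -ler_pdivrMr //.
  exact/ltW/truncnS_gt.
have [x Ex|z zE] := @int_ring_lift (d^-1 *: \val t ^+ k).
  rewrite hornerZ horner_exp Defs.valM (vV vd) -eval_atE.
  have te' : (e%:E <= v (eval_at x t))%E by apply: te => //; exact: t_gt0.
  apply: le_trans (leeD (lexx _) (v_exp_ge k te')).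
  by rewrite -EFinD lee_fin; lra.
exists ((q * \sum_(i < k) t ^+ i) *: c^T), z.
have -> : (w *m ((q * \sum_(i < k) t ^+ i) *: c^T)) 0 0 = 1 - t ^+ k.
  have wc : (w *m c^T) 0 0 = g by rewrite -[w]trmxK -trmx_mul mxE.
  rewrite -scalemxAr mxE wc.
  have -> : 1 - t ^+ k = - (t ^+ k - 1) by rewrite opprB.
  by rewrite subrX1 -mulNr opprB /t subKr mulrC mulrA.
by rewrite rmorphB rmorph1 rmorphXn zE mul_polyC scalerA divff // scale1r.
Qed.

(** The values on V of a polynomial are bounded below, so a large power of an
    element t of positive value is a common denominator. *)
Lemma common_denominator n m (A : 'M[{poly K}]_(n, m)) :
  exists2 d, d != 0 & exists B : 'M[D]_(n, m), map_mx val B = d%:P *: A.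
Proof.
have [t [r [r0 vt]]] := positive_valuation v.
have big_pow (s : R) : exists k : nat, - s <= k%:R * r.
  by exists (Num.truncn (- s / r)).+1; rewrite -ler_pdivrMr //; exact/ltW/truncnS_gt.
have mono k k' y : (k <= k')%N -> (0 <= v (t ^+ k * y)%R)%E -> (0 <= v (t ^+ k' * y)%R)%E.
  move=> /subnK <- h; rewrite exprD -mulrA Defs.valM adde_ge0 //.
  by rewrite (vX _ vt) lee_fin mulr_ge0 // ltW.
have bound (p : {poly K}) : exists k : nat, forall x, (0 <= v x)%E ->
    (0 <= v (t ^+ k * p.[x])%R)%E.
  elim/poly_ind: p => [|p c [k IH]].
    by exists 0%N => x _; rewrite horner0 mulr0 Defs.val0 leey.
  have [l cl] : exists l, (0 <= v (t ^+ l * c)%R)%E.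
    have [->|/(v_finE v)[s vc]] := eqVneq c 0.
      by exists 0%N; rewrite mulr0 Defs.val0 leey.
    have [l ls] := big_pow s; exists l.
    by rewrite Defs.valM vc (vX _ vt) -EFinD lee_fin -lerBlDr sub0r.
  exists (maxn k l) => x x0; rewrite hornerMXaddC mulrDr.
  apply: le_trans (Defs.valD v _ _); rewrite le_min mulrA.
  rewrite (mono l) ?leq_maxr // andbT Defs.valM adde_ge0 //.
  by rewrite (mono k) ?leq_maxl // IH.
have /choice[k kP] := fun ij : 'I_n * 'I_m => bound (A ij.1 ij.2).
pose M := \max_ij k ij.
have /choice[B BP] : forall ij : 'I_n * 'I_m, exists f : D,
    \val f = (t ^+ M)%:P * A ij.1 ij.2.
  move=> ij; apply: int_ring_lift => x /E_sub_V Vx.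
  by rewrite hornerM hornerC (mono (k ij)) ?leq_bigmax // kP.
exists (t ^+ M); first by rewrite expf_neq0 // (v_neq0 vt).
by exists (\matrix_(i, j) B (i, j)); apply/matrixP => i j; rewrite !mxE BP.
Qed.

(** * A rank-one idempotent with rows in the submodule *)

Lemma unit_content_entries n m (B : 'M[D]_(n, m)) (G : 'I_n -> 'I_m -> D) x :
    \sum_i \sum_j G i j * B i j = 1 -> E x ->
  exists i j, v (eval_at x (B i j)) = 0%E.
Proof.
move=> GB Ex; apply: contrapT => nB.
have : (0 < v (eval_at x (1 : D)%R))%E.
  rewrite -GB rmorph_sum; apply: v_sum_gt => i _.
  rewrite rmorph_sum; apply: v_sum_gt => j _; rewrite rmorphM mulrC.
  apply: v_gt0M; last exact: eval_at_ge0.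
  rewrite lt_neqAle eval_at_ge0 // andbT eq_sym; apply/eqP => B0.
  by apply: nB; exists i, j.
by rewrite rmorph1 v1 ltxx.
Qed.

(** Each nonzero row w of the row space of B is, over K[X], some h times a
    unimodular row, but constant multiples of the latter need not be in the row
    space of B. This is repaired by means of a row e in the row space that is
    unimodular over K[X]: unless w is a multiple of e, a translate of w by a
    constant multiple of e is itself unimodular over K[X], and the constant can
    be chosen of positive value, so that the residues of w are kept. *)
Lemma saturated_row n m (B : 'M[D]_(n, m)) (G : 'I_n -> 'I_m -> D) :
    \sum_i \sum_j G i j * B i j = 1 ->
  exists (c c0 : 'rV[D]_n) (h : {poly K}) (u0 : 'cV[{poly K}]_m),
    [/\ residually_unimodular (c *m B), mval (c *m B) = h *: mval (c0 *m B) &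
        mval (c0 *m B) *m u0 = 1%:M].
Proof.
move=> GB.
have [c cP] := row_combination_with_units (fun x => unit_content_entries GB).
have [|a [u au]] := @unit_bilinear_value _ _ _ (mval B) (fun i j => \val (G i j)).
  rewrite -[RHS](rmorph1 (val : D -> {poly K})) -GB rmorph_sum.
  apply: eq_bigr => i _; rewrite rmorph_sum; apply: eq_bigr => j _.
  by rewrite mxE rmorphM.
have [d d0 [c0 c0E]] := common_denominator a.
pose e := c0 *m B; pose u1 := d^-1%:P *: u.
have eu : mval e *m u1 = 1%:M.
  rewrite map_mxM c0E -!scalemxAl -scalemxAr au scalerA -polyCM mulfV //.
  by rewrite scale1r.
(* If c B is a multiple of e, then e itself serves as the unimodular row. *)
have [we|[p p0 pP]] := unimodular_translate (mval (c *m B)) eu.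
  by exists c, c0, ((mval (c *m B) *m u1) 0 0), u1.
have [t [r [r0 vt]]] := positive_valuation v.
(* Distinct constants of positive value, as many as the degree of p requires. *)
pose s := [seq t ^+ k.+1 | k <- iota 0 (size p)].
have s_uniq : uniq s.
  rewrite map_inj_uniq ?iota_uniq // => k k' /(congr1 v).
  by rewrite !(vX _ vt) => -[] /(mulIf (lt0r_neq0 r0))/eqP; rewrite eqr_nat => /eqP[].
have [|l /mapP[k _ lE] cop] :=
    coprimep_translate ((mval (c *m B) *m u1) 0 0) p0 s_uniq.
  by rewrite size_map size_iota.
have [u0 u0E] := pP l cop.
have l_gt0 : (0 < v l)%E by rewrite lE (vX _ vt) lte_fin mulr_gt0.
have [L [LE Lx]] := int_ring_const (ltW l_gt0).
have cE : (c + L *: c0) *m B = c *m B + L *: e by rewrite mulmxDl -scalemxAl.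
exists (c + L *: c0), (c + L *: c0), 1, u0; split.
- move=> x Ex; have [j cj] := cP x Ex; exists j.
  rewrite cE mxE [(L *: e) 0 j]mxE rmorphD rmorphM /= Lx v0D // v_gt0M //.
  exact: eval_at_ge0.
- by rewrite scale1r.
- by rewrite -[RHS]u0E cE map_mxD map_mxZ -LE.
Qed.

(** The matrix p = a w + z (d u0) w0 is built from two coefficient rows in D, one
    for w and one for w0, while over K[X], where w = h w0, it is the product of
    the column u' = h a + z d u0 and the row w0. *)
Lemma rank_one_matrix n m (B : 'M[D]_(n, m)) (G : 'I_n -> 'I_m -> D) :
    \sum_i \sum_j G i j * B i j = 1 ->
  exists q : 'M[D]_(m, n), let p := q *m B in
    \tr p = 1 /\ forall i j k l, p i j * p k l = p i l * p k j.
Proof.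
move=> /saturated_row[c [c0 [h [u0 [c_unit cE c0u]]]]].
have [d d0 [U UE]] := common_denominator u0.
have [a [z azE]] := unimodular_modulo_const d0 c_unit.
exists (a *m c + (z *: U) *m c0); set p := _ *m B.
pose u' := h *: mval a + (\val z * d%:P) *: u0.
have pE : mval p = u' *m mval (c0 *m B).
  rewrite /p mulmxDl -!mulmxA map_mxD (map_mxM _ a) cE (map_mxM _ (z *: U)).
  by rewrite map_mxZ UE scalerA /u' mulmxDl -scalemxAr -!scalemxAl.
have pijE i j : \val (p i j) = u' i 0 * (mval (c0 *m B)) 0 j.
  by have /matrixP/(_ i j) := pE; rewrite [LHS]mxE [RHS]mxE big_ord1.
split; last first.
  move=> i j k l; apply/val_inj; rewrite [LHS]rmorphM [RHS]rmorphM.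
  by rewrite /= !pijE mulrACA [RHS]mulrACA [X in _ * X]mulrC.
apply/val_inj; rewrite [LHS]rmorph_sum [RHS]rmorph1.
transitivity ((mval (c0 *m B) *m u') 0 0).
  by rewrite mxE; apply: eq_bigr => i _; rewrite [LHS]pijE mulrC.
rewrite mulmxDr -!scalemxAr scalemxAl -cE -map_mxM c0u mxE [mval _ 0 0]mxE azE.
by rewrite !mxE mulr1 mulrC subrK.
Qed.

End IntegerValued.

Theorem theorem4p3 (K : fieldType) (R : realType)
    (v : rank_one_valuation K R) (E : set K)
    (E_sub_V : E `<=` [set` valuation_ring v])
    (no_pseudo_div : ~ exists x : nat -> K,
       (forall n, E (x n)) /\ pseudo_divergent v x)
    (no_pseudo_stat : ~ exists x : nat -> K,
       (forall n, E (x n)) /\ pseudo_stationary v x) :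
  UCS (int_ring v E).
Proof.
move=> m N _ content1.
have [n [x [xN /mx_content_unit[G GB]]]] : submod_content N 1 by rewrite content1.
have [q [p_tr p_minor]] :=
  rank_one_matrix E_sub_V no_pseudo_div no_pseudo_stat GB.
exists (fixed_rows (q *m \matrix_i x i) : submodClosed _); split.
- move=> y /eqP <-; suff: [set` N] (y *m (q *m \matrix_i x i)) by [].
  rewrite -xN mulmxA mulmx_sum_row; exists ((y *m q) 0) => //.
  by apply: eq_bigr => i _; rewrite rowK.
- exact: fixed_rows_rank_one.
- exact: fixed_rows_summand.
Qed.
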